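(* Let $K:\mathbb{R}\to\mathbb{R}$ and $\omega_1:\mathbb{R}^+\times\mathbb{R}^+\to\mathbb{R}$, where $\mathbb{R}^+=[0,+\infty)$, satisfy the following conditions. 1) $K(x)>0$ for $x\in\mathbb{R}$; $K(-t)=K(t)$ for $t\in\mathbb{R}^+$; $K$ is continuously differentiable on $\mathbb{R}$, and $K$ and $K'$ are bounded on $\mathbb{R}$. 2) $K$ is monotonically decreasing on $\mathbb{R}^+$ and $\int_0^\infty K(t)\,dt=\frac12$. 3) $\int_0^\infty xK(x)\,dx<+\infty$. $a_0$) $\omega_1(t,0)=0$ for all $t\in\mathbb{R}^+$. $a_1$) $\omega_1$ is continuous on $\mathbb{R}^+\times\mathbb{R}^+$ and, for each fixed $t\in\mathbb{R}^+$, the function $u\mapsto\omega_1(t,u)$ is monotonically increasing on $\mathbb{R}^+$. $a_2$) For each $t\in\mathbb{R}^+$ the supremum $\mu_1(t):=\sup_{u\in\mathbb{R}^+}\omega_1(t,u)$ exists (is finite), the function $\mu_1$ is continuous on $\mathbb{R}^+$ with $\lim_{t\to+\infty}\mu_1(t)=0$, and $\int_0^\infty t\,\mu_1(t)\,dt<+\infty$. Then the integral equation $$f(x)=\int_0^\infty\big(K(x-t)-K(x+t)\big)\big(f(t)+\omega_1(t,f(t))\big)\,dt,\qquad x\in\mathbb{R}^+,$$ has a one-parameter family $\{f_\gamma\}_{\gamma\in(0,+\infty)}$ of non-negative, continuous and linearly increasing (that is, of linear growth at infinity) solutions on $\mathbb{R}^+$; moreover, for each $\gamma\in(0,+\infty)$,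 $$\lim_{x\to+\infty}\frac{f_\gamma(x)}{x}=\gamma.$$
   Context: $\mathbb{R}^+:=[0,+\infty)$. ''Monotonically increasing'' and ''monotonically decreasing'' are understood strictly. A solution is a function $f:\mathbb{R}^+\to[0,+\infty)$ satisfying the equation for every $x\in\mathbb{R}^+$. *)

(* Defs.v *)
From HB Require Import structures.
From mathcomp Require Import all_boot all_order all_algebra.
From mathcomp Require Import all_classical all_reals all_analysis.

Set Implicit Arguments.
Unset Strict Implicit.
Unset Printing Implicit Defensive.

Import Order.TTheory GRing.Theory Num.Theory.
Import numFieldNormedType.Exports.

Local Open Scope classical_set_scope.
Local Open Scope ring_scope.

(* Functions with domain [Rplus] (or [Rplus `*` Rplus]) are represented by
   total functions on [R]; their values at negative arguments are never used. *)
Definition Rplus (R : realType) : set R := `[0, +oo[%classic.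
Arguments Rplus : clear implicits.

(* [sup] is [0] on sets without a supremum, so [has_sup] has to be required
   separately for [sup_on_Rplus w t] to be the actual supremum. *)
Definition sup_on_Rplus (R : realType) (w : R -> R -> R) (t : R) : R :=
  sup [set w t u | u in Rplus R].

Definition integrand (R : realType) (K : R -> R) (w : R -> R -> R)
    (f : R -> R) (x t : R) : R :=
  (K (x - t) - K (x + t)) * (f t + w t (f t)).

(* Integrability is part of the equation: the integral converges absolutely
   and equals [f x]. *)
Definition is_solution (R : realType) (K : R -> R) (w : R -> R -> R)
    (f : R -> R) : Prop :=
  [/\ forall x : R, 0 <= x -> 0 <= f x,
      forall x : R, 0 <= x ->
        lebesgue_measure.-integrable (Rplus R) (EFin \o integrand K w f x)
    & forall x : R, 0 <= x ->
        ((f x)%:E =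
          \int[lebesgue_measure]_(t in Rplus R) (integrand K w f x t)%:E)%E].

Definition linear_growth (R : realType) (f : R -> R) : Prop :=
  exists c C : R,
    [/\ 0 < c, 0 < C & \forall x \near +oo, c * x <= f x <= C * x].

(* Main.v *)
Require Import Defs.
From HB Require Import structures.
From mathcomp Require Import all_boot all_order all_algebra.
From mathcomp Require Import all_classical all_reals all_analysis.
From mathcomp Require Import measurable_realfun lra.

Set Implicit Arguments.
Unset Strict Implicit.
Unset Printing Implicit Defensive.

Import Order.TTheory GRing.Theory Num.Theory.
Import numFieldNormedType.Exports.

Local Open Scope classical_set_scope.
Local Open Scope ring_scope.

(** Write [L h] for the function [x |-> int_0^oo (K (x - t) - K (x + t)) h t dt].
    The kernel is nonnegative because [K] is even and decreasing, so [L] is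
    monotone, and so is [f |-> L (f + w1 (., f))].  The solution with slope
    [gamma] is the limit of the iterates of that map, started from
    [gamma * x] ([iterate_limit_solution]).

    Let [H] be the odd extension to the line of a function [h] on the
    half-line.  Then [L h] is the convolution of [K] and [H], and since [K] is
    even of total mass 1,
      h x - L h x = int_0^oo K u (2 H x - H (x + u) - H (x - u)) du.
    Everything about [L] is read off these odd second differences.  They vanish
    for a linear function, so [L (gamma x) = gamma x], the iteration starts with
    a subsolution and its iterates increase.  What remains is an upper barrier
    that stays within a constant of [gamma * x]: a function [U] with
    [L (U + mu1) <= U], where [mu1 t] is the supremum of [w1 t]
    ([supersolution_exists]).

    The barrier is [U x = A + C * P x + gamma * x] with
      P x = int_0^oo S x y mu1 y dy,   S x y = int_0^oo min x z K (y - z) dz.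
    As [min x z] is the Green function of minus the second derivative on the
    half-line with value 0 at the origin, [P] is concave with second derivative
    minus the smoothed weight [int K (x - y) mu1 y dy].  It is bounded, because
    [S x y <= y + int_0^oo t K t dt] and [mu1] has a finite first moment
    ([potential_bounded]).

    All odd second differences of [min x z] in [x] are nonnegative, and those
    with step [u] in [2, 3] are at least 1 as soon as [x >= 2] and
    [|x - z| <= 1].  By the monotonicity of [K] the value [K (x - y)] is at most
    a constant times the mass that [K (y - .)] gives to the interval
    [|x - z| <= 1] ([kernel_local_average]).  So for [x >= 2], [P x - L P x] is
    at least a constant times the smoothed weight, which dominates [L mu1 x]
    ([potential_second_difference]).  For [x < 2] the constant [A] does this
    job: its odd extension jumps at the origin, so steps [u > x] see a positive
    second difference, while the smoothed weight is at most
    [K 0 * int_0^oo mu1].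

    The iterates are therefore squeezed between [gamma * x] and
    [B + gamma * x].  Their limit solves the equation by monotone convergence,
    it is continuous because convolution with [K] sends functions of at most
    linear growth to continuous ones ([convolution_continuous]), and the
    squeeze gives the asymptotic slope [gamma]. *)

(** * Integrals over the half-line *)

Section HalfLineIntegral.
Context {R : realType}.
Local Notation mu := (@lebesgue_measure R).

Lemma RplusE (t : R) : Rplus R t = (0 <= t) :> Prop.
Proof. by rewrite /Rplus /= in_itv/= andbT. Qed.

Lemma measurable_Rplus : measurable (Rplus R : set (measurableTypeR R)).
Proof. exact: measurable_itv. Qed.
Hint Resolve measurable_Rplus : core.

Definition Iplus (f : R -> R) : \bar R := (\int[mu]_(t in Rplus R) (f t)%:E)%E.

Lemma eq_Iplus (f g : R -> R) :
  (forall t, 0 <= t -> f t = g t) -> Iplus f = Iplus g.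
Proof. by move=> fg; apply: eq_integral => t /set_mem; rewrite RplusE => /fg ->. Qed.

Lemma Iplus_ge0 (f : R -> R) : (forall t, 0 <= t -> 0 <= f t) -> (0 <= Iplus f)%E.
Proof. by move=> f0; apply: integral_ge0 => t; rewrite RplusE lee_fin; apply: f0. Qed.

Lemma le_Iplus (f g : R -> R) :
  measurable_fun (Rplus R) f -> measurable_fun (Rplus R) g ->
  (forall t, 0 <= t -> 0 <= f t <= g t) -> (Iplus f <= Iplus g)%E.
Proof.
move=> mf mg fg; apply: ge0_le_integral => //.
- by move=> t; rewrite RplusE lee_fin => /fg/andP[].
- exact/measurable_EFinP.
- exact/measurable_EFinP.
- by move=> t; rewrite RplusE lee_fin => /fg/andP[].
Qed.

Lemma IplusD (f g : R -> R) :
  measurable_fun (Rplus R) f -> measurable_fun (Rplus R) g ->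
  (forall t, 0 <= t -> 0 <= f t) -> (forall t, 0 <= t -> 0 <= g t) ->
  Iplus (fun t => f t + g t) = (Iplus f + Iplus g)%E.
Proof.
move=> mf mg f0 g0; rewrite /Iplus -ge0_integralD//.
- by move=> t; rewrite RplusE lee_fin; apply: f0.
- exact/measurable_EFinP.
- by move=> t; rewrite RplusE lee_fin; apply: g0.
- exact/measurable_EFinP.
Qed.

Lemma IplusZ (c : R) (f : R -> R) :
  measurable_fun (Rplus R) f -> (forall t, 0 <= t -> 0 <= f t) -> 0 <= c ->
  Iplus (fun t => c * f t) = (c%:E * Iplus f)%E.
Proof.
move=> mf f0 c0; rewrite /Iplus -ge0_integralZl_EFin//.
- by move=> t; rewrite RplusE lee_fin; apply: f0.
- exact/measurable_EFinP.
Qed.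

Lemma Iplus_integrable (f : R -> R) :
  measurable_fun (Rplus R) f -> (forall t, 0 <= t -> 0 <= f t) ->
  (Iplus f < +oo)%E -> mu.-integrable (Rplus R) (EFin \o f).
Proof.
move=> mf f0 foo; apply/integrableP; split; first exact/measurable_EFinP.
apply: le_lt_trans foo; rewrite le_eqVlt; apply/orP; left; apply/eqP.
apply: eq_integral => t /set_mem; rewrite RplusE => t0 /=.
by rewrite ger0_norm// f0.
Qed.

Lemma fineK_Iplus (f : R -> R) :
  (forall t, 0 <= t -> 0 <= f t) -> (Iplus f < +oo)%E ->
  (fine (Iplus f))%:E = Iplus f.
Proof. by move=> f0 foo; rewrite fineK// ge0_fin_numE// Iplus_ge0. Qed.

Lemma Iplus_cst_itv (a b c : R) : 0 <= a -> a <= b ->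
  Iplus (fun t => if (a <= t) && (t <= b) then c else 0) = (c * (b - a))%:E.
Proof.
move=> a0 ab; rewrite /Iplus.
transitivity (\int[mu]_(t in Rplus R) ((cst c%:E) \_ `[a, b]) t)%E.
  apply: eq_integral => t _; rewrite patchE /=.
  have -> : (t \in `[a, b]%classic) = (a <= t <= b).
    by apply/idP/idP; rewrite inE /= in_itv.
  by case: ifP.
rewrite -integral_mkcondr setIidr; last first.
  by move=> t; rewrite RplusE /= in_itv/= => /andP[/(le_trans a0)].
have -> : (\int[mu]_(t in `[a, b]) cst c%:E t = c%:E * mu `[a, b])%E.
  by rewrite -integral_cst//; exact: measurable_itv.
rewrite lebesgue_measure_itv/=.
rewrite lte_fin; case: ltP => [_|ba]; first by rewrite -EFinB -EFinM.
by have -> : b - a = 0 by lra.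
Qed.

Lemma measurable_cst_itv (D : set R) (a b c : R) :
  measurable_fun D (fun t : R => if (a <= t) && (t <= b) then c else 0).
Proof.
apply: measurable_funTS; apply: measurable_fun_ifT => //.
by apply: measurable_and; apply: measurable_fun_ler.
Qed.

Lemma measurable_translation (d : R) :
  measurable_fun [set: measurableTypeR R] ((fun u => d + u) : _ -> measurableTypeR R).
Proof. exact: measurable_funD. Qed.

Lemma lebesgue_measureD (d : R) (A : set R) : measurable A ->
  pushforward mu ((fun u => d + u) : _ -> measurableTypeR R) A = mu A.
Proof.
move=> mA; apply/esym; apply: (@lebesgue_measure_unique R
  (measure_function_pushforward__canonical__measure_function_Measure mu
    (measurable_translation d))) => //= _ [[a b]] _ <-.
rewrite /pushforward.
have -> : (fun u => d + u) @^-1` `]a, b]%classic = `]a - d, b - d]%classic.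
  by apply/seteqP; split => t /=; rewrite !in_itv/= ltrBlDl lerBrDl.
rewrite !lebesgue_measure_itv/= !lte_fin ltrD2r -!EFinB; case: ifP => // _.
by congr (_%:E); lra.
Qed.

Lemma ge0_integral_translation (d : R) (F : R -> \bar R) :
  measurable_fun setT F -> (forall t, 0 <= F t)%E ->
  (\int[mu]_t F t = \int[mu]_u F (d + u)%R)%E.
Proof.
move=> mF F0; have md := measurable_translation d.
rewrite -[RHS](@ge0_integral_pushforward _ _ _ _ _ _ md mu setT F)//.
by apply: eq_measure_integral => A mA _; exact/esym/lebesgue_measureD.
Qed.

Lemma ge0_integral_fold (F : R -> \bar R) :
  measurable_fun setT F -> (forall t, 0 <= F t)%E ->
  (\int[mu]_t F t = \int[mu]_(u in Rplus R) (F u + F (- u)%R))%E.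
Proof.
move=> mF F0.
have mFN : measurable_fun setT (fun u : R => F (- u)) by exact: measurableT_comp.
rewrite ge0_integralD//; try exact: measurable_funS mF; try exact: measurable_funS mFN.
have -> : (\int[mu]_(u in Rplus R) F (- u)%R)%E = (\int[mu]_(u in `]-oo, 0%R]) F u)%E.
  rewrite (ge0_integration_by_substitution0 mFN)//.
  by apply: eq_integral => u _; rewrite opprK.
have -> : [set: R] = Rplus R `|` `]-oo, 0%R[.
  apply/seteqP; split => // t _.
  by case: (leP 0 t) => t0; [left; rewrite RplusE|right; rewrite /= in_itv].
rewrite ge0_integral_setU//; last 2 first.
- exact: measurable_funS mF.
- apply/disj_set2P/seteqP; split => // t []; rewrite RplusE /= in_itv/= => t0.
  by rewrite ltNge t0.
congr (_ + _)%E; rewrite integral_itv_bndo_bndc//.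
exact: measurable_funS mF.
Qed.

End HalfLineIntegral.

(** * Convolution with an even kernel, centred at the point of evaluation *)

Section Reflection.
Context {R : realType} (K : R -> R).
Local Notation mu := (@lebesgue_measure R).
Context (K_cont : continuous K) (K_ge0 : forall x, 0 <= K x).
Context (K_sym : forall x, K (- x) = K x).

Lemma measurable_kernel_comp (D : set R) (g : R -> R) :
  measurable_fun D g -> measurable_fun D (fun t => K (g t)).
Proof.
by move=> mg; apply: measurableT_comp => //; exact: continuous_measurable_fun.
Qed.

Lemma measurable_subl (D : set R) (x : R) : measurable_fun D (fun t : R => x - t).
Proof. exact: measurable_funB. Qed.

Lemma measurable_addl (D : set R) (x : R) : measurable_fun D (fun t : R => x + t).
Proof. exact: measurable_funD. Qed.

(** Extension by zero.  The odd extension of [h] is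
    [t |-> zext h t - zext h (- t)]; keeping its two parts on opposite sides of
    an inequality keeps all integrands nonnegative. *)
Definition zext (h : R -> R) (t : R) : R := if 0 <= t then h t else 0.

Lemma zextE (h : R -> R) (t : R) : 0 <= t -> zext h t = h t.
Proof. by rewrite /zext => ->. Qed.

Lemma zext_ge0 (h : R -> R) : (forall t, 0 <= t -> 0 <= h t) -> forall t, 0 <= zext h t.
Proof. by move=> h0 t; rewrite /zext; case: ifP => // /h0. Qed.

Lemma zext_patch (h : R -> R) : zext h = h \_ (Rplus R).
Proof.
apply/funext => t; rewrite /zext patchE; congr (if _ then _ else _).
by apply/idP/idP; rewrite inE RplusE.
Qed.

Lemma measurable_zext (h : R -> R) :
  measurable_fun (Rplus R) h -> measurable_fun setT (zext h).
Proof. by rewrite zext_patch => mh; exact/(measurable_restrictT _ measurable_Rplus). Qed.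

Lemma Iplus_zext (f g h : R -> R) :
  (forall t, f t = g t * zext h t) ->
  (\int[mu]_t (f t)%:E)%E = Iplus (fun t => g t * h t).
Proof.
move=> fE; rewrite /Iplus [RHS]integral_mkcond; apply: eq_integral => t _.
rewrite fE zext_patch !patchE; case: ifP => // _; by rewrite mulr0.
Qed.

(** Substituting [t = x + u] and folding the line at [u = 0] uses the evenness
    of [K] to expose the two values at distance [u] from [x]. *)
Lemma Iplus_kernel_sub (x : R) (h : R -> R) :
  measurable_fun (Rplus R) h -> (forall t, 0 <= t -> 0 <= h t) ->
  Iplus (fun t => K (x - t) * h t) =
  Iplus (fun u => K u * (zext h (x + u) + zext h (x - u))).
Proof.
move=> mh h0; have mz := measurable_zext mh; have z0 := zext_ge0 h0.
pose f t : \bar R := (K (x - t) * zext h t)%:E.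
have mf : measurable_fun setT f.
  apply/measurable_EFinP/measurable_funM => //.
  by apply: measurable_kernel_comp; exact: measurable_subl.
have f0 t : (0 <= f t)%E by rewrite lee_fin mulr_ge0.
have mfx : measurable_fun setT (fun u : R => f (x + u)).
  exact: (measurableT_comp mf (@measurable_addl setT x)).
transitivity (\int[mu]_t f t)%E; first exact/esym/Iplus_zext.
rewrite (ge0_integral_translation x mf f0).
rewrite (ge0_integral_fold mfx (fun u => f0 (x + u))).
apply: eq_integral => u _; rewrite /f.
have -> : x - (x + u) = - u by lra.
have -> : x - (x - u) = u by lra.
by rewrite K_sym -EFinD mulrDr.
Qed.

Lemma Iplus_kernel_add (x : R) (h : R -> R) : 0 <= x ->
  measurable_fun (Rplus R) h -> (forall t, 0 <= t -> 0 <= h t) ->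
  Iplus (fun t => K (x + t) * h t) = Iplus (fun u => K u * zext h (u - x)).
Proof.
move=> x0 mh h0; have mz := measurable_zext mh; have z0 := zext_ge0 h0.
pose f t : \bar R := (K (x + t) * zext h t)%:E.
have mf : measurable_fun setT f.
  apply/measurable_EFinP/measurable_funM => //.
  by apply: measurable_kernel_comp; exact: measurable_addl.
have f0 t : (0 <= f t)%E by rewrite lee_fin mulr_ge0.
transitivity (\int[mu]_t f t)%E; first exact/esym/Iplus_zext.
rewrite (ge0_integral_translation (- x) mf f0).
apply: Iplus_zext => u.
have -> : x + (- x + u) = u by lra.
rewrite addrC /zext; case: (leP 0 u) => // u0; case: leP => //; lra.
Qed.

End Reflection.

(** Measurability of arithmetic combinations of affine functions, of the kernel
    and of functions known to be measurable. *)
Ltac mfun := repeat first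
  [ exact: measurable_id | exact: measurable_cst | done
  | by apply: measurable_funTS | exact: measurable_cst_itv
  | apply: measurable_funB | apply: measurable_funD | apply: measurable_funM
  | apply: measurable_kernel_comp ].

(** * Odd second differences and the operator *)

Section Barrier.
Context {R : realType} (K : R -> R).
Context (K_cont : continuous K) (K_pos : forall x, 0 < K x).
Context (K_sym : forall x, K (- x) = K x).
Context (K_noninc : forall s t, 0 <= s -> s <= t -> K t <= K s).
Context (K_half : Iplus K = (2^-1)%:E).
Context (K_mom : (Iplus (fun t => t * K t)%R < +oo)%E).

Let K_ge0 x : 0 <= K x. Proof. exact/ltW/K_pos. Qed.
Let mK (D : set R) : measurable_fun D K.
Proof. by apply: measurable_funTS; exact: continuous_measurable_fun. Qed.

Lemma kernel_le (x y : R) : `|x| <= `|y| -> K y <= K x.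
Proof.
have K_abs z : K `|z| = K z by have [z0|z0] := ler0P z; rewrite ?K_sym.
by move=> xy; rewrite -(K_abs x) -(K_abs y) K_noninc.
Qed.

Lemma kernel_add_le_sub (x t : R) : 0 <= x -> 0 <= t -> K (x + t) <= K (x - t).
Proof.
move=> x0 t0; apply: kernel_le.
rewrite [X in _ <= X]ger0_norm ?addr_ge0// ler_norml; lra.
Qed.

Definition kernel_moment : R := fine (Iplus (fun t => t * K t)).

Lemma kernel_moment_ge0 : 0 <= kernel_moment.
Proof. by apply: fine_ge0; apply: Iplus_ge0 => t t0; rewrite mulr_ge0. Qed.

Lemma Iplus_kernel_affine (a b : R) : 0 <= a -> 0 <= b ->
  Iplus (fun u => K u * (a + b * u)) = (a / 2 + b * kernel_moment)%:E.
Proof.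
move=> a0 b0.
rewrite (@eq_Iplus _ _ (fun u => a * K u + b * (u * K u))); last by move=> t _; lra.
have tK0 (t : R) : 0 <= t -> 0 <= t * K t by move=> t0; rewrite mulr_ge0.
rewrite IplusD; [|by mfun|by mfun|by move=> *; rewrite mulr_ge0
  |by move=> *; rewrite mulr_ge0 ?tK0].
rewrite !IplusZ//; [|by mfun].
by rewrite K_half -(fineK_Iplus tK0 K_mom).
Qed.

(** After recentring at [x], the value of [a + b * t] at [x + u] plus that at
    [x - u] is at most [2 * (a + b * x) + b * u], whose integral against [K] is
    computed by the mass 1/2 and the first moment. *)
Lemma Iplus_kernel_sub_affine (a b x : R) : 0 <= a -> 0 <= b -> 0 <= x ->
  (Iplus (fun t => K (x - t) * (a + b * t))%R <=
   (a + b * x + b * kernel_moment)%R%:E)%E.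
Proof.
move=> a0 b0 x0; pose h (t : R) := a + b * t.
have mh D : measurable_fun D h by rewrite /h; mfun.
have h0 t : 0 <= t -> 0 <= h t by move=> t0; rewrite addr_ge0// mulr_ge0.
rewrite (Iplus_kernel_sub K_cont K_ge0 K_sym x (mh _) h0).
have -> : (a + b * x + b * kernel_moment)%:E =
    Iplus (fun u => K u * ((2 * a + 2 * b * x) + b * u)).
  rewrite Iplus_kernel_affine//; first by congr (_%:E); lra.
  by rewrite addr_ge0// !mulr_ge0.
apply: le_Iplus; [| |].
- apply: measurable_funM => //; apply: measurable_funD.
    apply: measurable_funTS; apply: measurableT_comp => //.
    exact: measurable_zext.
    exact: measurable_addl.
  apply: measurable_funTS; apply: measurableT_comp => //.
  exact: measurable_zext.
  exact: measurable_subl.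
- by mfun.
- move=> u u0; rewrite mulr_ge0 ?addr_ge0 ?zext_ge0//= ler_wpM2l//.
  have bu : 0 <= b * u by rewrite mulr_ge0.
  have bx : 0 <= b * x by rewrite mulr_ge0.
  rewrite zextE ?addr_ge0// /zext /h; case: ifP => _; lra.
Qed.

Section OddKernel.
Context (h : R -> R) (a b : R).
Context (mh : measurable_fun (Rplus R) h) (h0 : forall t, 0 <= t -> 0 <= h t).
Context (a0 : 0 <= a) (b0 : 0 <= b).
Context (h_affine : forall t, 0 <= t -> h t <= a + b * t).

Lemma Iplus_odd_kernel_split (x : R) : 0 <= x ->
  (Iplus (fun t => (K (x - t) - K (x + t)) * h t)%R +
   Iplus (fun t => K (x + t) * h t)%R = Iplus (fun t => K (x - t) * h t)%R)%E.
Proof.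
move=> x0; rewrite -IplusD; first by apply: eq_Iplus => t _; lra.
- by mfun.
- by mfun.
- by move=> t t0; rewrite mulr_ge0 ?h0// subr_ge0 kernel_add_le_sub.
- by move=> t t0; rewrite mulr_ge0 ?h0.
Qed.

Lemma Iplus_kernel_add_lty (x : R) : 0 <= x ->
  (Iplus (fun t => K (x + t) * h t)%R < +oo)%E.
Proof.
move=> x0; apply: (@le_lt_trans _ _ (Iplus (fun t => K t * (a + b * t))%R)).
  apply: le_Iplus => [||t t0]; [by mfun|by mfun|].
  rewrite mulr_ge0 ?h0//= ler_pM ?h0 ?h_affine//.
  by rewrite K_noninc// lerDr.
by rewrite Iplus_kernel_affine// ltry.
Qed.

Lemma Iplus_odd_kernel_lty (x : R) : 0 <= x ->
  (Iplus (fun t => (K (x - t) - K (x + t)) * h t)%R < +oo)%E.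
Proof.
move=> x0; apply: le_lt_trans (le_lt_trans (Iplus_kernel_sub_affine a0 b0 x0) (ltry _)).
apply: le_Iplus => [||t t0]; [by mfun|by mfun|].
have k0 : 0 <= K (x - t) - K (x + t) by rewrite subr_ge0 kernel_add_le_sub.
by rewrite mulr_ge0 ?h0//= ler_pM ?h0 ?h_affine// gerDl oppr_le0.
Qed.

(** The hypothesis is a lower bound by [delta], for steps [u] in [2, 3], on the
    odd second difference of [h] at [x]; integrating it against [K] gives a
    lower bound on [h x - L h x], since [K] is at least [K 3] on [2, 3].  The
    two halves of the odd kernel are kept apart until the end, when the finite
    integral of [K (x + t) * h t] is cancelled. *)
Lemma Iplus_odd_kernel_excess (x delta : R) : 0 <= x -> 0 <= delta ->
  (forall u, 0 <= u ->
    h (x + u) + zext h (x - u) + (if (2 <= u) && (u <= 3) then delta else 0)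
      <= 2 * h x + zext h (u - x)) ->
  (Iplus (fun t => (K (x - t) - K (x + t)) * h t)%R + (K 3 * delta)%:E
    <= (h x)%:E)%E.
Proof.
move=> x0 delta0 hx; have mz := measurable_zext mh; have z0 := zext_ge0 h0.
have foo := Iplus_kernel_add_lty x0.
have split_x := Iplus_odd_kernel_split x0.
have fin_add : Iplus (fun t => K (x + t) * h t) \is a fin_num.
  by rewrite ge0_fin_numE// Iplus_ge0// => t t0; rewrite mulr_ge0 ?h0.
rewrite -(@leeD2rE _ (Iplus (fun t => K (x + t) * h t)))// addeAC split_x.
rewrite (Iplus_kernel_sub K_cont K_ge0 K_sym x mh h0).
rewrite (Iplus_kernel_add K_cont K_ge0 x0 mh h0).
have -> : (K 3 * delta)%:E =
    Iplus (fun u => if (2 <= u) && (u <= 3) then K 3 * delta else 0).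
  by rewrite Iplus_cst_itv//; [congr (_%:E)|]; lra.
have -> : (h x)%:E = Iplus (fun u => K u * (2 * h x + 0 * u)).
  by rewrite Iplus_kernel_affine// ?mulr_ge0 ?h0//; congr (_%:E); lra.
have mzD : measurable_fun (Rplus R) (fun u : R => zext h (x + u)).
  apply: measurable_funTS; exact: (measurableT_comp mz (@measurable_addl R setT x)).
have mzB : measurable_fun (Rplus R) (fun u : R => zext h (x - u)).
  apply: measurable_funTS; exact: (measurableT_comp mz (@measurable_subl R setT x)).
have mzC : measurable_fun (Rplus R) (fun u : R => zext h (u - x)).
  apply: measurable_funTS; apply: (measurableT_comp mz).
  by apply: measurable_funB => //.
have Kd0 : 0 <= K 3 * delta by rewrite mulr_ge0.
have lhs0 u : 0 <= u -> 0 <= K u * (zext h (x + u) + zext h (x - u)).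
  by move=> u0; apply: mulr_ge0 => //; exact: addr_ge0.
have rhs0 u : 0 <= u -> 0 <= K u * (2 * h x + 0 * u).
  by move=> u0; rewrite mulr_ge0// mul0r addr0 mulr_ge0 ?h0.
have zC0 u : 0 <= u -> 0 <= K u * zext h (u - x).
  by move=> u0; rewrite mulr_ge0.
have I0 (u : R) : 0 <= u -> 0 <= (if (2 <= u) && (u <= 3) then K 3 * delta else 0).
  by move=> u0; case: ifP.
have m1 : measurable_fun (Rplus R) (fun u => K u * (zext h (x + u) + zext h (x - u))).
  by mfun.
have m2 : measurable_fun (Rplus R)
    (fun u => if (2 <= u) && (u <= 3) then K 3 * delta else 0) by mfun.
have m3 : measurable_fun (Rplus R) (fun u => K u * (2 * h x + 0 * u)) by mfun.
have m4 : measurable_fun (Rplus R) (fun u => K u * zext h (u - x)) by mfun.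
rewrite -(IplusD m1 m2 lhs0 I0) -(IplusD m3 m4 rhs0 zC0).
apply: le_Iplus => [||u u0]; [exact: measurable_funD|exact: measurable_funD|].
apply/andP; split; first by apply: addr_ge0; [exact: lhs0|exact: I0].
have /(ler_wpM2l (K_ge0 u)) := hx _ u0.
rewrite mulrDr [in X in _ <= X -> _]mulrDr (zextE h (addr_ge0 x0 u0)) mul0r addr0.
apply: le_trans.
rewrite lerD2l; case: ifP => [/andP[_ u3]|_]; last by rewrite mulr0.
by rewrite ler_wpM2r// K_noninc.
Qed.

End OddKernel.

Lemma Iplus_odd_kernel_linear (gamma x : R) : 0 <= gamma -> 0 <= x ->
  Iplus (fun t => (K (x - t) - K (x + t)) * (gamma * t)) = (gamma * x)%:E.
Proof.
move=> g0 x0; pose h (t : R) := gamma * t.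
have mh : measurable_fun (Rplus R) h by rewrite /h; mfun.
have h0 t : 0 <= t -> 0 <= h t by move=> t0; rewrite mulr_ge0.
have h_affine t : 0 <= t -> h t <= 0 + gamma * t by rewrite add0r.
have foo := Iplus_kernel_add_lty mh h0 (lexx 0) g0 h_affine x0.
have fin_add : Iplus (fun t => K (x + t) * h t) \is a fin_num.
  by rewrite ge0_fin_numE// Iplus_ge0// => t t0; rewrite mulr_ge0 ?h0.
have := Iplus_odd_kernel_split mh h0 x0.
rewrite (Iplus_kernel_sub K_cont K_ge0 K_sym x mh h0).
rewrite [X in _ = X -> _](@eq_Iplus _ _ (fun u => K u * (2 * (gamma * x) + 0 * u) + K u * zext h (u - x))).
  rewrite IplusD.
  - rewrite Iplus_kernel_affine ?mulr_ge0// -(Iplus_kernel_add K_cont K_ge0 x0 mh h0).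
    move/(congr1 (fun z => z - Iplus (fun t => K (x + t) * h t)%R))%E.
    rewrite !addeK// => E; transitivity ((2 * (gamma * x)) / 2 + 0 * kernel_moment)%:E.
      exact: E.
    by congr (_%:E); lra.
  - by mfun.
  - apply: measurable_funM => //; apply: measurable_funTS.
    apply: (measurableT_comp (measurable_zext mh)); exact: measurable_funB.
  - by move=> u u0; rewrite mulr_ge0// mul0r addr0 !mulr_ge0.
  - by move=> u u0; rewrite mulr_ge0// zext_ge0.
move=> u u0; rewrite -mulrDr; congr (_ * _).
rewrite /zext /h addr_ge0// !subr_ge0.
by case: (ltgtP u x) => [_|_|->]; lra.
Qed.

End Barrier.

(** * Continuity of convolutions with functions of linear growth *)

Section Continuity.
Context {R : realType} (K : R -> R).
Local Notation mu := (@lebesgue_measure R).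
Context (K_cont : continuous K) (K_pos : forall x, 0 < K x).
Context (K_sym : forall x, K (- x) = K x).
Context (K_noninc : forall s t, 0 <= s -> s <= t -> K t <= K s).
Context (K_half : Iplus K = (2^-1)%:E).
Context (K_mom : (Iplus (fun t => t * K t)%R < +oo)%E).
Context (phi : R -> R) (a b : R).
Context (mphi : measurable_fun (Rplus R) phi).
Context (phi0 : forall t, 0 <= t -> 0 <= phi t).
Context (a0 : 0 <= a) (b0 : 0 <= b).
Context (phi_affine : forall t, 0 <= t -> phi t <= a + b * t).

Let K_ge0 x : 0 <= K x. Proof. exact/ltW/K_pos. Qed.

(** Translates of [K] by a bounded amount are dominated by a multiple of a
    single translate: for [t >= r] by monotonicity, and for [t < r] because the
    left side is at most [K 0] and [K (r - t)] is at least [K r]. *)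
Lemma kernel_translate_le (r x t : R) : - r < x -> x < r -> 0 <= t ->
  K (x - t) <= K 0 / K r * K (r - t).
Proof.
move=> rx xr t0; have Kle := kernel_le K_sym K_noninc.
have [rt|tr] := leP r t.
  apply: (@le_trans _ _ (K (r - t))).
    by apply: Kle; rewrite ler0_norm ?ler0_norm; lra.
  by rewrite ler_peMl// ler_pdivlMr// mul1r Kle// normr0.
apply: (@le_trans _ _ (K 0)); first by rewrite Kle// normr0.
rewrite mulrAC ler_pdivlMr// ler_pM2l//.
by apply: Kle; rewrite !ger0_norm; lra.
Qed.

(** Dominated convergence, with the dominating function given by
    [kernel_translate_le]. *)
Lemma convolution_continuous :
  continuous (fun x => fine (Iplus (fun t => K (x - t) * phi t))).
Proof.
move=> x; pose r := `|x| + 1; pose c := K 0 / K r.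
have r0 : 0 <= r by rewrite addr_ge0.
have c0 : 0 <= c by rewrite divr_ge0.
pose g (t : R) := K (r - t) * (c * a + c * b * t).
have mg : measurable_fun (Rplus R) g by rewrite /g; mfun.
have g0 t : 0 <= t -> 0 <= g t.
  move=> t0; apply: mulr_ge0 => //; apply: addr_ge0; first exact: mulr_ge0.
  by apply: mulr_ge0 => //; exact: mulr_ge0.
have goo : (Iplus g < +oo)%E.
  apply: le_lt_trans (Iplus_kernel_sub_affine K_cont K_pos K_sym K_half K_mom _ _ r0) _.
  - by rewrite mulr_ge0.
  - by rewrite mulr_ge0.
  - exact: ltry.
have mf (y : R) : measurable_fun (Rplus R) (fun t => K (y - t) * phi t) by mfun.
have f0 (y t : R) : 0 <= t -> 0 <= K (y - t) * phi t.
  by move=> t0; rewrite mulr_ge0 ?phi0.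
have fg (y t : R) : - r < y -> y < r -> 0 <= t -> K (y - t) * phi t <= g t.
  move=> ry yr t0; have := kernel_translate_le ry yr t0.
  rewrite -/c => Kc; apply: (@le_trans _ _ (c * K (r - t) * (a + b * t))).
    by rewrite ler_pM ?phi0 ?phi_affine.
  by rewrite /g; lra.
apply: (@continuity_under_integral R _ _ mu (fun y t => K (y - t) * phi t)
  (Rplus R) measurable_Rplus (- r) r _ _ g).
- move=> y; rewrite /= in_itv/= => /andP[ry yr].
  apply: Iplus_integrable (mf y) (@f0 y) _.
  apply: le_lt_trans goo; apply: le_Iplus => // t t0.
  by rewrite f0//= fg.
- apply: aeW => t _ y _.
  apply: cvgMl; apply: continuous_comp; last exact: K_cont.
  by apply: cvgB; [exact: cvg_id|exact: cvg_cst].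
- exact: Iplus_integrable.
- move=> y; rewrite /= in_itv/= => /andP[ry yr]; apply: aeW => t.
  by rewrite RplusE => t0; rewrite ger0_norm ?f0// fg.
- rewrite inE /= in_itv/= /r; apply/andP; split.
    by rewrite ltrNl; apply: le_lt_trans (ler_norm _) _; rewrite normrN ltrDl.
  by apply: le_lt_trans (ler_norm _) _; rewrite ltrDl.
Qed.

Lemma odd_kernel_continuous :
  {within Rplus R, continuous
    (fun x => fine (Iplus (fun t => (K (x - t) - K (x + t)) * phi t)))}.
Proof.
pose G x := fine (Iplus (fun t => K (x - t) * phi t)).
apply: (@subspace_eq_continuous _ _ _ (fun x => G x - G (- x))).
  move=> x /set_mem; rewrite RplusE => x0; apply/eqP; rewrite subr_eq; apply/eqP.
  have split_x := Iplus_odd_kernel_split K_cont K_pos K_sym K_noninc mphi phi0 x0.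
  have add_oo := Iplus_kernel_add_lty K_cont K_pos K_noninc K_half K_mom mphi phi0 a0 b0 phi_affine x0.
  have GN : G (- x) = fine (Iplus (fun t => K (x + t) * phi t)).
    by congr (fine _); apply: eq_Iplus => t _; rewrite -opprD K_sym.
  rewrite GN /G -split_x fineD//.
  - rewrite ge0_fin_numE.
      exact: (Iplus_odd_kernel_lty K_cont K_pos K_sym K_noninc K_half K_mom mphi phi0 a0 b0).
    apply: Iplus_ge0 => t t0.
    by rewrite mulr_ge0 ?phi0// subr_ge0; apply: kernel_add_le_sub.
  - by rewrite ge0_fin_numE// Iplus_ge0// => t t0; rewrite mulr_ge0 ?phi0.
apply: continuous_subspaceT => x; apply: cvgB.
  exact: convolution_continuous.
by apply: continuous_comp; [exact: cvgN|exact: convolution_continuous].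
Qed.

End Continuity.

(** * The barrier *)

Section SecondDifference.
Context {R : realType}.

(** A lower bound [e] on the odd second differences of a family [g] in its
    first variable passes to the superpositions [G] of that family with weight
    [w]. *)
Lemma second_difference_Iplus (g : R -> R -> R) (G w e : R -> R) (x u : R) :
  0 <= x -> 0 <= u ->
  measurable_fun (Rplus R) w -> (forall z, 0 <= z -> 0 <= w z) ->
  measurable_fun (Rplus R) e -> (forall z, 0 <= z -> 0 <= e z) ->
  (forall y, 0 <= y -> measurable_fun (Rplus R) (g y)) ->
  (forall y z, 0 <= y -> 0 <= z -> 0 <= g y z) ->
  (forall y, 0 <= y -> (G y)%:E = Iplus (fun z => g y z * w z)) ->
  (forall z, 0 <= z ->
    (g (x + u) z + zext (g^~ z) (x - u)) * w z + e z <=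
    (2 * g x z + zext (g^~ z) (u - x)) * w z) ->
  ((G (x + u) + zext G (x - u))%:E + Iplus e <= (2 * G x + zext G (u - x))%:E)%E.
Proof.
move=> x0 u0 mw w0 me e0 mg g0 GE gle.
have xu0 : 0 <= x + u by exact: addr_ge0.
have mz t : measurable_fun (Rplus R) (fun z => zext (g^~ z) t).
  by rewrite /zext; case: (boolP (0 <= t)) => // t0; exact: mg.
have z0 (t z : R) : 0 <= z -> 0 <= zext (g^~ z) t.
  by move=> zge0; apply: zext_ge0 => y y0; exact: g0.
have zGE t : (zext G t)%:E = Iplus (fun z => zext (g^~ z) t * w z).
  rewrite /zext; case: (boolP (0 <= t)) => [t0|_]; first exact: GE.
  rewrite (@eq_Iplus _ _ (fun=> 0)); last by move=> ? _; rewrite mul0r.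
  by rewrite /Iplus integral0.
rewrite !EFinD EFinM !zGE !GE//.
have gw0 (y z : R) : 0 <= y -> 0 <= z -> 0 <= g y z * w z.
  by move=> *; apply: mulr_ge0; [exact: g0|exact: w0].
have zw0 (t z : R) : 0 <= z -> 0 <= zext (g^~ z) t * w z.
  by move=> *; apply: mulr_ge0; [exact: z0|exact: w0].
have mgw y : 0 <= y -> measurable_fun (Rplus R) (fun z => g y z * w z).
  by move=> /mg ?; apply: measurable_funM.
have mzw t : measurable_fun (Rplus R) (fun z => zext (g^~ z) t * w z).
  exact: measurable_funM.
have D1 := IplusD (mgw _ xu0) (mzw (x - u)) (fun z => gw0 _ z xu0) (zw0 (x - u)).
rewrite -D1.
have m1 : measurable_fun (Rplus R) (fun z => g (x + u) z * w z + zext (g^~ z) (x - u) * w z).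
  by apply: measurable_funD; [exact: mgw|].
have n1 (z : R) : 0 <= z -> 0 <= g (x + u) z * w z + zext (g^~ z) (x - u) * w z.
  by move=> ?; apply: addr_ge0; [exact: gw0|exact: zw0].
rewrite -(IplusD m1 me n1 e0) -(IplusZ (mgw _ x0) (fun z => gw0 _ z x0) (ler0n _ 2)).
have m2 : measurable_fun (Rplus R) (fun z => 2 * (g x z * w z)).
  by apply: measurable_funM => //; exact: mgw.
have n2 (z : R) : 0 <= z -> 0 <= 2 * (g x z * w z).
  by move=> ?; apply: mulr_ge0 => //; exact: gw0.
rewrite -(IplusD m2 (mzw (u - x)) n2 (zw0 (u - x))).
apply: le_Iplus => [||z zge0]; [exact: measurable_funD|exact: measurable_funD|].
rewrite addr_ge0 ?n1 ?e0//=.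
by have := gle z zge0; lra.
Qed.

End SecondDifference.

Section MinDifference.
Context {R : realType}.

(** On the half-line [min x z] is concave and vanishes at 0, hence is subadditive
    as well; this makes its odd second differences nonnegative even when the
    step crosses the origin. *)
Lemma min_second_difference (x u z : R) : 0 <= x -> 0 <= u -> 0 <= z ->
  Num.min (x + u) z + zext (Num.min^~ z) (x - u) <=
  2 * Num.min x z + zext (Num.min^~ z) (u - x).
Proof.
move=> x0 u0 z0; rewrite /zext !minEle.
case: (leP (x + u) z) => ?; case: (leP x z) => ?; case: (leP 0 (x - u)) => ?;
case: (leP (x - u) z) => ?; case: (leP 0 (u - x)) => ?; case: (leP (u - x) z) => ?; lra.
Qed.

(** A step of length at least 2 from [x] crosses the kink of [min x z] at [z],
    which lies within 1 of [x], and overshoots it by at least 1; a step of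
    length at most 3 does not go past the second kink, which the odd extension
    has at [- z]. *)
Lemma min_second_difference_gap (x u z : R) :
  2 <= x -> 2 <= u -> u <= 3 -> x - 1 <= z -> z <= x + 1 ->
  Num.min (x + u) z + zext (Num.min^~ z) (x - u) + 1 <=
  2 * Num.min x z + zext (Num.min^~ z) (u - x).
Proof.
move=> x2 u2 u3 xz zx; rewrite /zext !minEle.
case: (leP (x + u) z) => ?; case: (leP x z) => ?; case: (leP 0 (x - u)) => ?;
case: (leP (x - u) z) => ?; case: (leP 0 (u - x)) => ?; case: (leP (u - x) z) => ?; lra.
Qed.

End MinDifference.

Section Supersolution.
Context {R : realType} (K : R -> R).
Context (K_cont : continuous K) (K_pos : forall x, 0 < K x).
Context (K_sym : forall x, K (- x) = K x).
Context (K_noninc : forall s t, 0 <= s -> s <= t -> K t <= K s).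
Context (K_half : Iplus K = (2^-1)%:E).
Context (K_mom : (Iplus (fun t => t * K t)%R < +oo)%E).
Context (m : R -> R) (mm : measurable_fun (Rplus R) m).
Context (m0 : forall t, 0 <= t -> 0 <= m t).
Context (m_int : (Iplus m < +oo)%E).
Context (m_mom : (Iplus (fun t => t * m t)%R < +oo)%E).

Let K_ge0 x : 0 <= K x. Proof. exact/ltW/K_pos. Qed.
Let Kle := kernel_le K_sym K_noninc.

Definition smoothed_min (x y : R) : R := fine (Iplus (fun z => K (y - z) * Num.min x z)).

Definition smoothed_weight (x : R) : R := fine (Iplus (fun y => K (x - y) * m y)).

Definition potential (x : R) : R := fine (Iplus (fun y => smoothed_min x y * m y)).

Let mmin (x : R) : measurable_fun (Rplus R) (fun z : R => Num.min x z).
Proof. by apply: measurable_funTS; apply: measurable_minr. Qed.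

Let min0 (x z : R) : 0 <= x -> 0 <= z -> 0 <= Num.min x z.
Proof. by move=> x0 z0; rewrite le_min x0. Qed.

Let mKmin (x y : R) : measurable_fun (Rplus R) (fun z => K (y - z) * Num.min x z).
Proof. by apply: measurable_funM => //; mfun. Qed.

Let Kmin0 (x y z : R) : 0 <= x -> 0 <= z -> 0 <= K (y - z) * Num.min x z.
Proof. by move=> x0 z0; rewrite mulr_ge0 ?min0. Qed.

(** The bound is uniform in [x] because [min x z <= z]; this is what makes the
    potential bounded. *)
Lemma Iplus_smoothed_min_le (x y : R) : 0 <= x -> 0 <= y ->
  (Iplus (fun z => K (y - z) * Num.min x z)%R <= (y + kernel_moment K)%:E)%E.
Proof.
move=> x0 y0.
have := Iplus_kernel_sub_affine K_cont K_pos K_sym K_half K_mom (lexx 0) ler01 y0.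
rewrite add0r !mul1r; apply: le_trans; apply: le_Iplus => // [|z z0].
  by mfun.
by rewrite Kmin0//= ler_wpM2l// add0r mul1r ge_min lexx orbT.
Qed.

Lemma smoothed_minE (x y : R) : 0 <= x -> 0 <= y ->
  (smoothed_min x y)%:E = Iplus (fun z => K (y - z) * Num.min x z).
Proof.
move=> x0 y0; rewrite fineK_Iplus// => [t t0|]; first exact: Kmin0.
by apply: le_lt_trans (ltry _); exact: Iplus_smoothed_min_le.
Qed.

Lemma smoothed_min_ge0 (x y : R) : 0 <= x -> 0 <= smoothed_min x y.
Proof. by move=> x0; apply: fine_ge0; apply: Iplus_ge0 => z z0; exact: Kmin0. Qed.

Lemma smoothed_min_le (x y : R) : 0 <= x -> 0 <= y ->
  smoothed_min x y <= kernel_moment K + y.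
Proof. by move=> x0 y0; rewrite -lee_fin smoothed_minE// addrC Iplus_smoothed_min_le. Qed.

Lemma smoothed_min_nondecreasing (x x' y : R) : 0 <= x -> x <= x' -> 0 <= y ->
  smoothed_min x y <= smoothed_min x' y.
Proof.
move=> x0 xx' y0; rewrite -lee_fin !smoothed_minE//; last exact: le_trans xx'.
apply: le_Iplus => // z z0; rewrite Kmin0//= ler_wpM2l//.
by rewrite le_min ge_min xx' /= ge_min lexx orbT.
Qed.

(** As a function of [y], [smoothed_min x] is a convolution with [K], hence
    continuous. *)
Lemma measurable_smoothed_min (D : set R) (x : R) : 0 <= x ->
  measurable_fun D (smoothed_min x).
Proof.
move=> x0; apply: measurable_funTS; apply: continuous_measurable_fun.
apply: (@convolution_continuous _ _ K_cont K_pos K_sym K_noninc K_half K_mom _ 0 1) => //.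
- by move=> t t0; exact: min0.
- by move=> t t0; rewrite add0r mul1r ge_min lexx orbT.
Qed.

(** The unit interval [j, j + 1] extends from [x] to the side of [y].  A point
    [z] of it is no farther from [y] than [x] is, except when both are within 1
    of [y]; then the factor [K 1 / K 0] compensates. *)
Lemma kernel_local_average (x y z : R) :
  let j := if y <= x then x - 1 else x in
  j <= z -> z <= j + 1 -> K 1 / K 0 * K (x - y) <= K (y - z).
Proof.
move=> j jz zj; rewrite mulrAC ler_pdivrMr//.
have [yz1|yz1] := leP `|y - z| 1.
  apply: ler_pM => //; apply: Kle; last by rewrite normr0.
  by rewrite [leRHS]ger0_norm.
rewrite mulrC; apply: ler_pM => //; apply: Kle; last by rewrite normr0.
move: jz zj yz1; rewrite /j; case: (leP y x) => yx jz zj.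
  rewrite [X in _ -> _ <= X](@ger0_norm _ (x - y)); last by lra.
  by case: (leP 0 (y - z)) => yz; [rewrite ger0_norm|rewrite ltr0_norm]; lra.
rewrite [X in _ -> _ <= X](@ltr0_norm _ (x - y)); last by lra.
by case: (leP 0 (y - z)) => yz; [rewrite ger0_norm|rewrite ltr0_norm]; lra.
Qed.

(** The gap of [min_second_difference_gap] is integrated over the unit interval
    of [kernel_local_average], on which [K (y - z)] is comparable to
    [K (x - y)]. *)
Lemma smoothed_min_second_difference (x u y : R) : 0 <= x -> 0 <= u -> 0 <= y ->
  smoothed_min (x + u) y + zext (smoothed_min^~ y) (x - u) +
    (if [&& 2 <= x, 2 <= u & u <= 3] then K 1 / K 0 * K (x - y) else 0) <=
  2 * smoothed_min x y + zext (smoothed_min^~ y) (u - x).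
Proof.
move=> x0 u0 y0; set c := K 1 / K 0 * K (x - y).
have c0 : 0 <= c by rewrite mulr_ge0// divr_ge0.
pose j := if y <= x then x - 1 else x.
pose gap := [&& 2 <= x, 2 <= u & u <= 3].
pose e (z : R) := if (j <= z) && (z <= j + 1) then (if gap then c else 0) else 0.
have e0 (z : R) : 0 <= z -> 0 <= e z by rewrite /e; case: ifP => // _; case: ifP.
have me : measurable_fun (Rplus R) e by exact: measurable_cst_itv.
have Ie : Iplus e = (if gap then c else 0)%:E.
  case: (boolP gap) => gapx.
    have j0 : 0 <= j by move: gapx; rewrite /gap /j => /and3P[x2 _ _]; case: (leP y x); lra.
    rewrite /e gapx Iplus_cst_itv//; last by lra.
    by congr (_%:E); lra.
  rewrite (@eq_Iplus _ _ (fun=> 0)); first by rewrite /Iplus integral0.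
  by move=> z _; rewrite /e (negbTE gapx); case: ifP.
rewrite -lee_fin EFinD -Ie.
apply: (@second_difference_Iplus _ Num.min (smoothed_min^~ y) (fun z => K (y - z))) => //.
- by mfun.
- by move=> x' x'0; rewrite smoothed_minE//; apply: eq_Iplus => z _; rewrite mulrC.
- move=> z z0; rewrite /e; case: ifP => [/andP[jz zj]|_]; last first.
    by rewrite addr0 ler_wpM2r// min_second_difference.
  case: (boolP gap) => [/and3P[x2 u2 u3]|_]; last first.
    by rewrite addr0 ler_wpM2r// min_second_difference.
  have xz : x - 1 <= z by move: jz; rewrite /j; case: (leP y x); lra.
  have zx : z <= x + 1 by move: zj; rewrite /j; case: (leP y x); lra.
  have := ler_wpM2r (K_ge0 (y - z)) (min_second_difference_gap x2 u2 u3 xz zx).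
  apply: le_trans; rewrite [leRHS]mulrDl mul1r lerD2l.
  exact: kernel_local_average.
Qed.

Let affine_weight_lty : (Iplus (fun y => (kernel_moment K + y) * m y)%R < +oo)%E.
Proof.
have k0 := kernel_moment_ge0 K_pos.
rewrite (@eq_Iplus _ _ (fun y => kernel_moment K * m y + y * m y)); last first.
  by move=> y _; rewrite mulrDl.
rewrite IplusD; [|by mfun|by mfun|by move=> *; rewrite mulr_ge0 ?m0
  |by move=> *; rewrite mulr_ge0 ?m0].
rewrite IplusZ// lte_add_pinfty// lte_mul_pinfty// ?lee_fin//.
Qed.

Let msm (x : R) : 0 <= x -> measurable_fun (Rplus R) (fun y => smoothed_min x y * m y).
Proof. by move=> x0; apply: measurable_funM => //; exact: measurable_smoothed_min. Qed.

Let sm0 (x y : R) : 0 <= x -> 0 <= y -> 0 <= smoothed_min x y * m y.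
Proof. by move=> x0 y0; rewrite mulr_ge0 ?m0 ?smoothed_min_ge0. Qed.

Let Iplus_potential_le (x : R) : 0 <= x ->
  (Iplus (fun y => smoothed_min x y * m y)%R <=
   Iplus (fun y => (kernel_moment K + y) * m y)%R)%E.
Proof.
move=> x0; apply: le_Iplus => [||y y0]; [exact: msm|by mfun|].
by rewrite sm0//= ler_wpM2r ?m0// smoothed_min_le.
Qed.

Lemma potentialE (x : R) : 0 <= x ->
  (potential x)%:E = Iplus (fun y => smoothed_min x y * m y).
Proof.
move=> x0; rewrite fineK_Iplus// => [t t0|]; first exact: sm0.
exact: le_lt_trans (Iplus_potential_le x0) affine_weight_lty.
Qed.

Lemma potential_ge0 (x : R) : 0 <= x -> 0 <= potential x.
Proof. by move=> x0; apply: fine_ge0; apply: Iplus_ge0 => z z0; exact: sm0. Qed.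

Lemma potential_bounded : exists2 B, 0 <= B & forall x, 0 <= x -> potential x <= B.
Proof.
exists (fine (Iplus (fun y => (kernel_moment K + y) * m y))).
  apply: fine_ge0; apply: Iplus_ge0 => y y0.
  by rewrite mulr_ge0 ?m0// addr_ge0// kernel_moment_ge0.
move=> x x0; rewrite -lee_fin potentialE// fineK_Iplus//; first exact: Iplus_potential_le.
by move=> y y0; rewrite mulr_ge0 ?m0// addr_ge0// kernel_moment_ge0.
Qed.

(** Monotonicity gives measurability; the argument is truncated at 0 because the
    estimates on [potential] are for nonnegative arguments. *)
Lemma measurable_potential : measurable_fun (Rplus R) potential.
Proof.
pose f (x : R) := potential (Num.max 0 x).
suff mf : measurable_fun (Rplus R) f.
  apply: (eq_measurable_fun f) mf => x /set_mem; rewrite RplusE /f => x0.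
  by rewrite max_r.
apply: (nondecreasing_measurable measurable_Rplus) => x x' xx'; rewrite /f.
have p0 : 0 <= Num.max 0 x by rewrite le_max lexx.
have p'0 : 0 <= Num.max 0 x' by rewrite le_max lexx.
have pp' : Num.max 0 x <= Num.max 0 x' by rewrite ge_max p'0 le_max xx' orbT.
move: (Num.max 0 x) (Num.max 0 x') p0 p'0 pp' => y y' y0 y'0 yy'.
rewrite -lee_fin (potentialE y0) (potentialE y'0); apply: le_Iplus => [||z z0]; [exact: msm|exact: msm|].
by rewrite sm0//=; apply: ler_wpM2r; [exact: m0|exact: smoothed_min_nondecreasing].
Qed.

Let mKm (x : R) : measurable_fun (Rplus R) (fun y => K (x - y) * m y).
Proof. by mfun. Qed.

Let Km0 (x y : R) : 0 <= y -> 0 <= K (x - y) * m y.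
Proof. by move=> y0; rewrite mulr_ge0 ?m0. Qed.

Let smoothed_weight_le_ereal (x : R) :
  (Iplus (fun y => K (x - y) * m y)%R <= (K 0 * fine (Iplus m))%R%:E)%E.
Proof.
rewrite EFinM fineK_Iplus// -IplusZ//.
apply: le_Iplus => [||y y0]; [by []|by mfun|].
by rewrite Km0//= ler_wpM2r ?m0// Kle// normr0.
Qed.

Lemma smoothed_weightE (x : R) :
  (smoothed_weight x)%:E = Iplus (fun y => K (x - y) * m y).
Proof.
rewrite fineK_Iplus// => [t t0|]; first exact: Km0.
exact: le_lt_trans (smoothed_weight_le_ereal x) (ltry _).
Qed.

Lemma smoothed_weight_ge0 (x : R) : 0 <= smoothed_weight x.
Proof. by apply: fine_ge0; apply: Iplus_ge0 => z z0; exact: Km0. Qed.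

Lemma smoothed_weight_le (x : R) : smoothed_weight x <= K 0 * fine (Iplus m).
Proof. by rewrite -lee_fin smoothed_weightE; exact: smoothed_weight_le_ereal. Qed.

Lemma potential_second_difference (x u : R) : 0 <= x -> 0 <= u ->
  potential (x + u) + zext potential (x - u) +
    (if [&& 2 <= x, 2 <= u & u <= 3] then K 1 / K 0 * smoothed_weight x else 0) <=
  2 * potential x + zext potential (u - x).
Proof.
move=> x0 u0; pose q := K 1 / K 0; have q0 : 0 <= q by rewrite divr_ge0.
pose gap := [&& 2 <= x, 2 <= u & u <= 3].
pose e (y : R) := (if gap then q else 0) * (K (x - y) * m y).
have qgap : 0 <= (if gap then q else 0) by case: ifP.
have e0 (y : R) : 0 <= y -> 0 <= e y by move=> y0; rewrite mulr_ge0// Km0.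
have me : measurable_fun (Rplus R) e by apply: measurable_funM.
have Ie : Iplus e = (if gap then q * smoothed_weight x else 0)%:E.
  rewrite /e IplusZ// => [|y y0]; last exact: Km0.
  by rewrite -smoothed_weightE; case: ifP; rewrite ?mul0e.
rewrite -lee_fin EFinD -Ie.
apply: (@second_difference_Iplus _ smoothed_min potential m) => //.
- by move=> y y0; exact: measurable_smoothed_min.
- by move=> y z y0 z0; exact: smoothed_min_ge0.
- by move=> y y0; exact: potentialE.
- move=> y y0.
  have := ler_wpM2r (m0 y0) (smoothed_min_second_difference x0 u0 y0).
  apply: le_trans; rewrite [leRHS]mulrDl lerD2l /e -/gap -/q.
  by case: ifP => _; rewrite ?mulrA// !mul0r.
Qed.

(** The odd extension of a constant jumps at the origin, so a step [u > x]
    sees an excess of [2 * A], half of which is kept. *)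
Lemma constant_second_difference (A x u : R) : 0 <= A -> 0 <= x ->
  A + zext (fun=> A) (x - u) + (if [&& ~~ (2 <= x), 2 <= u & u <= 3] then A else 0) <=
  2 * A + zext (fun=> A) (u - x).
Proof.
move=> A0 x0; rewrite /zext !subr_ge0.
by case: (leP 2 x) => ?; case: (leP 2 u) => ?; case: (ltgtP u x) => ? /=;
  try case: ifP => _; lra.
Qed.

Lemma linear_second_difference (x u : R) :
  (x + u) + zext id (x - u) = 2 * x + zext id (u - x).
Proof. by rewrite /zext !subr_ge0; case: (ltgtP u x) => [_|_|->]; lra. Qed.

Lemma supersolution_exists (gamma : R) : 0 <= gamma ->
  exists U : R -> R, exists2 B : R, 0 <= B &
  [/\ measurable_fun (Rplus R) U,
      forall t, 0 <= t -> gamma * t <= U t <= B + gamma * t &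
      forall x, 0 <= x ->
        (Iplus (fun t => (K (x - t) - K (x + t)) * (U t + m t))%R <= (U x)%:E)%E].
Proof.
move=> gamma0; have [BH BH0 potB] := potential_bounded.
pose q := K 1 / K 0; have q0 : 0 < q by rewrite divr_gt0.
(* [A] and [C] are chosen so that [K 3 * delta], the excess that the steps in
   [2, 3] guarantee, dominates [smoothed_weight x] on both sides of [x = 2]. *)
pose A := K 0 * fine (Iplus m) / K 3; pose C := (K 3 * q)^-1.
have A0 : 0 <= A.
  by apply: divr_ge0 => //; apply: mulr_ge0 => //; apply: fine_ge0; exact: (Iplus_ge0 m0).
have C0 : 0 <= C by rewrite invr_ge0 mulr_ge0// ltW.
pose U t := A + C * potential t + gamma * t.
have mU : measurable_fun (Rplus R) U.
  apply: measurable_funD; last by mfun.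
  apply: measurable_funD; first by mfun.
  by apply: measurable_funM; [mfun|exact: measurable_potential].
have U_lo t : 0 <= t -> gamma * t <= U t.
  by move=> t0; rewrite lerDr addr_ge0// mulr_ge0// potential_ge0.
have U_hi t : 0 <= t -> U t <= (A + C * BH) + gamma * t.
  by move=> t0; rewrite lerD2r lerD2l ler_wpM2l// potB.
have U0 t : 0 <= t -> 0 <= U t.
  by move=> t0; apply: le_trans (U_lo t t0); rewrite mulr_ge0.
have B0 : 0 <= A + C * BH by rewrite addr_ge0// mulr_ge0.
exists U, (A + C * BH) => //; split => // [t t0|x x0]; first by rewrite U_lo ?U_hi.
pose delta := if 2 <= x then C * (q * smoothed_weight x) else A.
have delta0 : 0 <= delta.
  rewrite /delta; case: ifP => // _; apply: mulr_ge0 => //.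
  by apply: mulr_ge0; [exact: ltW|exact: smoothed_weight_ge0].
have weight_le : smoothed_weight x <= K 3 * delta.
  rewrite /delta; case: ifP => _.
    have KqC : K 3 * q * C = 1 by rewrite mulfV// gt_eqF// mulr_gt0.
    have -> : K 3 * (C * (q * smoothed_weight x)) = K 3 * q * C * smoothed_weight x by lra.
    by rewrite KqC mul1r.
  by rewrite /A mulrCA divff ?mulr1 ?smoothed_weight_le// gt_eqF.
have excess : (Iplus (fun t => (K (x - t) - K (x + t)) * U t)%R + (K 3 * delta)%:E
    <= (U x)%:E)%E.
  apply: (Iplus_odd_kernel_excess K_cont K_pos K_sym K_noninc K_half K_mom mU U0
    B0 gamma0 U_hi x0 delta0) => u u0.
  have H := ler_wpM2l C0 (potential_second_difference x0 u0).
  have HA := constant_second_difference u A0 x0.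
  have HL := congr1 (fun z => gamma * z) (linear_second_difference x u).
  have zextU t : zext U t = zext (fun=> A) t + C * zext potential t + gamma * zext id t.
    by rewrite /zext /U; case: ifP => _; rewrite ?mulr0 ?addr0.
  rewrite !zextU /U; move: H HA HL; rewrite /delta -/q.
  move: (zext _ _) (zext _ _) (zext _ _) (zext _ _) (zext _ _) (zext _ _).
  move: (potential _) (potential _) (smoothed_weight x).
  move=> p1 p2 s z1 z2 z3 z4 z5 z6.
  case: (2 <= x) => /=; case: (2 <= u); case: (u <= 3) => /=; lra.
rewrite (@eq_Iplus _ _ (fun t => (K (x - t) - K (x + t)) * U t +
    (K (x - t) - K (x + t)) * m t)); last by move=> t _; rewrite mulrDr.
have k0 (t : R) : 0 <= t -> 0 <= K (x - t) - K (x + t).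
  by move=> t0; rewrite subr_ge0; apply: kernel_add_le_sub.
have mk : measurable_fun (Rplus R) (fun t => (K (x - t) - K (x + t)) * m t) by mfun.
rewrite IplusD//; [|by mfun|by move=> t t0; rewrite mulr_ge0 ?k0 ?U0
  |by move=> t t0; rewrite mulr_ge0 ?k0 ?m0].
apply: le_trans excess; apply: leeD2l.
apply: le_trans (_ : ((smoothed_weight x)%:E <= _)%E); last by rewrite lee_fin.
rewrite smoothed_weightE; apply: le_Iplus => // t t0.
by rewrite mulr_ge0 ?k0 ?m0//= ler_wpM2r ?m0// gerDl oppr_le0.
Qed.

End Supersolution.

(** * Monotone iteration *)

Section Iteration.
Context {R : realType} (K : R -> R) (w : R -> R -> R) (m U : R -> R) (gamma B M : R).
Local Notation mu := (@lebesgue_measure R).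
Context (K_cont : continuous K) (K_pos : forall x, 0 < K x).
Context (K_sym : forall x, K (- x) = K x).
Context (K_noninc : forall s t, 0 <= s -> s <= t -> K t <= K s).
Context (K_half : Iplus K = (2^-1)%:E).
Context (K_mom : (Iplus (fun t => t * K t)%R < +oo)%E).
Context (w_cont : {within Rplus R `*` Rplus R, continuous (fun p : R * R => w p.1 p.2)}).
Context (w_ge0 : forall t u, 0 <= t -> 0 <= u -> 0 <= w t u).
Context (w_mono : forall t u v, 0 <= t -> 0 <= u -> u <= v -> w t u <= w t v).
Context (w_le : forall t u, 0 <= t -> 0 <= u -> w t u <= m t).
Context (mm : measurable_fun (Rplus R) m) (m_le : forall t, 0 <= t -> m t <= M).
Context (mU : measurable_fun (Rplus R) U).
Context (gamma0 : 0 <= gamma) (B0 : 0 <= B) (M0 : 0 <= M).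
Context (U_bounds : forall t, 0 <= t -> gamma * t <= U t <= B + gamma * t).
Context (U_super : forall x, 0 <= x ->
  (Iplus (fun t => (K (x - t) - K (x + t)) * (U t + m t))%R <= (U x)%:E)%E).

(** Joint continuity on the closed quadrant, in the form that serves both for
    limits along the iterates and for continuity in the space variable. *)
Lemma nonlinearity_cvg (I : Type) (F : set_system I) {FF : Filter F} (a b : I -> R) (t u : R) :
  0 <= t -> 0 <= u ->
  (\forall i \near F, 0 <= a i) -> (\forall i \near F, 0 <= b i) ->
  a i @[i --> F] --> t -> b i @[i --> F] --> u ->
  w (a i) (b i) @[i --> F] --> w t u.
Proof.
move=> t0 u0 Fa Fb at_ bu.
have Dtu : (Rplus R `*` Rplus R) (t, u) by split; rewrite RplusE.
have /subspace_continuousP/(_ _ Dtu) /= wtu := w_cont.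
have ab : (fun i => (a i, b i)) @ F --> within (Rplus R `*` Rplus R) (nbhs (t, u)).
  move=> A DA; have FA : F [set i | (Rplus R `*` Rplus R) (a i, b i) -> A (a i, b i)].
    exact: (cvg_pair at_ bu) DA.
  apply: filterS3 FA Fa Fb => i Ai ai bi; apply: Ai.
  by split; rewrite RplusE.
exact: (@cvg_comp _ _ _ _ (fun p : R * R => w p.1 p.2) _ _ _ ab wtu).
Qed.

Definition reaction (f : R -> R) (t : R) : R := f t + w t (f t).

Definition integral_operator (f : R -> R) (x : R) : R :=
  fine (Iplus (fun t => (K (x - t) - K (x + t)) * reaction f t)).

Let between (f : R -> R) := forall t, 0 <= t -> gamma * t <= f t <= U t.

Let between_ge0 f : between f -> forall t, 0 <= t -> 0 <= f t.
Proof. by move=> fP t t0; have /andP[+ _] := fP t t0; apply: le_trans; rewrite mulr_ge0. Qed.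

Lemma reaction_ge0 f : between f -> forall t, 0 <= t -> 0 <= reaction f t.
Proof. by move=> fP t t0; have ft0 := between_ge0 fP t0; rewrite addr_ge0 ?w_ge0. Qed.

Lemma reaction_le f : between f ->
  forall t, 0 <= t -> reaction f t <= (B + M) + gamma * t.
Proof.
move=> fP t t0; have /andP[_ fU] := fP t t0; have /andP[_ UB] := U_bounds t0.
have := w_le t0 (between_ge0 fP t0); have := m_le t0.
by rewrite /reaction; lra.
Qed.

Lemma within_continuous_measurable (f : R -> R) :
  {within Rplus R, continuous f} -> measurable_fun (Rplus R) f.
Proof. exact: (@subspace_continuous_measurable_fun R (Rplus R) f measurable_Rplus). Qed.

Lemma measurable_reaction f : between f -> {within Rplus R, continuous f} ->
  measurable_fun (Rplus R) (reaction f).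
Proof.
move=> fP fc; apply: within_continuous_measurable.
apply/subspace_continuousP => t Rt.
have /subspace_continuousP/(_ _ Rt) ft := fc.
have t0 : 0 <= t by rewrite -RplusE.
apply: cvgD; first exact: ft.
have near0 : \forall s \near within (Rplus R) (nbhs t), 0 <= s.
  by rewrite near_withinE; apply: nearW => s; rewrite RplusE.
apply: nonlinearity_cvg => //; first exact: between_ge0.
- by apply: filterS near0 => s; exact: between_ge0.
- exact: cvg_within.
Qed.

Let odd0 (x t : R) : 0 <= x -> 0 <= t -> 0 <= K (x - t) - K (x + t).
Proof. by move=> x0 t0; rewrite subr_ge0; apply: kernel_add_le_sub. Qed.

Let modd (x : R) : measurable_fun (Rplus R) (fun t => K (x - t) - K (x + t)).
Proof. by mfun. Qed.

Lemma Iplus_odd_kernel_le (x : R) (f g : R -> R) : 0 <= x ->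
  measurable_fun (Rplus R) f -> measurable_fun (Rplus R) g ->
  (forall t, 0 <= t -> 0 <= f t <= g t) ->
  (Iplus (fun t => (K (x - t) - K (x + t)) * f t)%R <=
   Iplus (fun t => (K (x - t) - K (x + t)) * g t)%R)%E.
Proof.
move=> x0 mf mg fg; apply: le_Iplus => [||t t0]; [exact: measurable_funM|exact: measurable_funM|].
by have /andP[f0 fgt] := fg t t0; rewrite mulr_ge0 ?odd0//= ler_wpM2l ?odd0.
Qed.

Lemma integral_operator_le_barrier f x : measurable_fun (Rplus R) (reaction f) ->
  between f -> 0 <= x ->
  (Iplus (fun t => (K (x - t) - K (x + t)) * reaction f t)%R <= (U x)%:E)%E.
Proof.
move=> mf fP x0; apply: le_trans (U_super x0); apply: Iplus_odd_kernel_le => //.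
  exact: measurable_funD.
move=> t t0; rewrite reaction_ge0//=; have /andP[_ fU] := fP t t0.
by rewrite lerD// w_le// between_ge0.
Qed.

Lemma integral_operatorE f x : measurable_fun (Rplus R) (reaction f) ->
  between f -> 0 <= x ->
  (integral_operator f x)%:E =
  Iplus (fun t => (K (x - t) - K (x + t)) * reaction f t).
Proof.
move=> mf fP x0; rewrite fineK_Iplus// => [t t0|].
  by rewrite mulr_ge0 ?odd0 ?reaction_ge0.
exact: le_lt_trans (integral_operator_le_barrier mf fP x0) (ltry _).
Qed.

(** The upper bound is the supersolution property of [U]; the lower one is the
    invariance of linear functions together with the nonnegativity of [w]. *)
Lemma integral_operator_between f : measurable_fun (Rplus R) (reaction f) ->
  between f -> between (integral_operator f).
Proof.
move=> mf fP x x0; rewrite -!lee_fin integral_operatorE//.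
rewrite integral_operator_le_barrier// andbT.
rewrite -(Iplus_odd_kernel_linear K_cont K_pos K_sym K_noninc K_half K_mom gamma0 x0).
apply: Iplus_odd_kernel_le => // t t0.
rewrite mulr_ge0//=; have /andP[gf _] := fP t t0.
by apply: (le_trans gf); rewrite lerDl w_ge0// between_ge0.
Qed.

Lemma integral_operator_continuous f : measurable_fun (Rplus R) (reaction f) ->
  between f -> {within Rplus R, continuous (integral_operator f)}.
Proof.
move=> mf fP; apply: (@odd_kernel_continuous _ _ K_cont K_pos K_sym K_noninc K_half K_mom
  (reaction f) (B + M) gamma) => //; [exact: reaction_ge0|exact: addr_ge0|exact: reaction_le].
Qed.

Lemma integral_operator_mono f g :
  measurable_fun (Rplus R) (reaction f) -> measurable_fun (Rplus R) (reaction g) ->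
  between f -> between g -> (forall t, 0 <= t -> f t <= g t) ->
  forall x, 0 <= x -> integral_operator f x <= integral_operator g x.
Proof.
move=> mf mg fP gP fg x x0; rewrite -lee_fin !integral_operatorE//.
apply: Iplus_odd_kernel_le => // t t0; rewrite reaction_ge0//=.
by rewrite lerD ?fg// w_mono ?fg// between_ge0.
Qed.

Definition iterate (n : nat) : R -> R := iter n integral_operator (fun t => gamma * t).

Lemma iterate_between_continuous (n : nat) :
  between (iterate n) /\ {within Rplus R, continuous (iterate n)}.
Proof.
elim: n => [|n [IHb IHc]].
  split=> [t t0|]; first by have /andP[-> _] := U_bounds t0; rewrite lexx.
  by apply: continuous_subspaceT => t; apply: cvgMr; exact: cvg_id.
have mf := measurable_reaction IHb IHc.
by split; [exact: integral_operator_between|exact: integral_operator_continuous].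
Qed.

Let iterate_between n := (iterate_between_continuous n).1.

Let measurable_reaction_iterate n : measurable_fun (Rplus R) (reaction (iterate n)).
Proof. by have [? ?] := iterate_between_continuous n; exact: measurable_reaction. Qed.

Lemma iterate_nondecreasing t : 0 <= t -> nondecreasing_seq (fun n => iterate n t).
Proof.
move=> t0; apply/nondecreasing_seqP => n; elim: n t t0 => [|n IHn] t t0.
  by have /andP[] := iterate_between 1 t0.
exact: (integral_operator_mono (measurable_reaction_iterate n)
  (measurable_reaction_iterate n.+1) (iterate_between n) (iterate_between n.+1) IHn t0).
Qed.

Definition iterate_limit (t : R) : R := limn (fun n => iterate n t).

Lemma iterate_cvg t : 0 <= t -> iterate n t @[n --> \oo] --> iterate_limit t.
Proof.
move=> t0; apply: nondecreasing_is_cvgn; first exact: iterate_nondecreasing.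
by exists (U t) => _ [n _ <-]; have /andP[] := iterate_between n t0.
Qed.

Lemma iterate_limit_between : between iterate_limit.
Proof.
move=> t t0; have cv := iterate_cvg t0; apply/andP; split.
  by apply: limr_ge; [exact: cvgP cv|apply: nearW => n; have /andP[] := iterate_between n t0].
by apply: limr_le; [exact: cvgP cv|apply: nearW => n; have /andP[] := iterate_between n t0].
Qed.

Lemma reaction_iterate_cvg t : 0 <= t ->
  reaction (iterate n) t @[n --> \oo] --> reaction iterate_limit t.
Proof.
move=> t0; have cv := iterate_cvg t0; apply: cvgD => //.
apply: nonlinearity_cvg => //; last exact: cvg_cst.
- exact: between_ge0 iterate_limit_between _ t0.
- exact: nearW.
- by apply: nearW => n; exact: between_ge0 (iterate_between n) _ t0.
Qed.

Lemma measurable_reaction_limit : measurable_fun (Rplus R) (reaction iterate_limit).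
Proof.
apply: (measurable_fun_cvg measurable_reaction_iterate) => t.
by rewrite RplusE; exact: reaction_iterate_cvg.
Qed.

(** Monotone convergence under the integral, the reactions of the iterates
    being nondecreasing. *)
Lemma iterate_limit_fixed x : 0 <= x ->
  (iterate_limit x)%:E =
  Iplus (fun t => (K (x - t) - K (x + t)) * reaction iterate_limit t).
Proof.
move=> x0; pose g n t : \bar R := ((K (x - t) - K (x + t)) * reaction (iterate n) t)%:E.
have mg n : measurable_fun (Rplus R) (g n).
  by apply/measurable_EFinP; exact: measurable_funM.
have g0 n t : Rplus R t -> (0 <= g n t)%E.
  by rewrite RplusE => t0; rewrite lee_fin mulr_ge0 ?odd0 ?reaction_ge0.
have g_nd t : Rplus R t -> nondecreasing_seq (g ^~ t).
  rewrite RplusE => t0 n n' nn'; rewrite lee_fin ler_wpM2l ?odd0//.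
  have ff := iterate_nondecreasing t0 nn'.
  apply: lerD => //; apply: w_mono => //.
  exact: (between_ge0 (iterate_between n) t0).
have := @cvg_monotone_convergence _ _ _ mu (Rplus R) measurable_Rplus g mg g0 g_nd.
have -> : (\int[mu]_(t in Rplus R) limn (g^~ t))%E =
    Iplus (fun t => (K (x - t) - K (x + t)) * reaction iterate_limit t).
  apply: eq_integral => t /set_mem; rewrite RplusE => t0; apply/cvg_lim => //.
  apply: cvg_EFin; first exact: nearW.
  by apply: cvgMr; exact: reaction_iterate_cvg.
have -> : (fun n => \int[mu]_(t in Rplus R) g n t)%E = (fun n => (iterate n.+1 x)%:E).
  apply/funext => n; apply/esym.
  exact: (integral_operatorE (measurable_reaction_iterate n) (iterate_between n) x0).
move=> cvI; apply: cvg_unique cvI => //.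
apply: cvg_EFin; first exact: nearW.
by have := iterate_cvg x0; rewrite -(cvg_shiftS (fun n => iterate n x)).
Qed.

Lemma iterate_limit_solution :
  [/\ is_solution K w iterate_limit,
      {within Rplus R, continuous iterate_limit} &
      forall t, 0 <= t -> gamma * t <= iterate_limit t <= B + gamma * t].
Proof.
have sb := iterate_limit_between; have ms := measurable_reaction_limit.
split.
- split=> [|x x0|]; [exact: between_ge0| |exact: iterate_limit_fixed].
  apply: Iplus_integrable; first exact: measurable_funM.
    by move=> t t0; rewrite mulr_ge0 ?odd0 ?reaction_ge0.
  by rewrite -iterate_limit_fixed// ltry.
- apply: subspace_eq_continuous (integral_operator_continuous ms sb) => x /set_mem.
  rewrite RplusE => x0; exact: (congr1 fine (esym (iterate_limit_fixed x0))).
- move=> t t0; have /andP[-> /=] := sb t t0; have /andP[_] := U_bounds t0.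
  by move=> /[swap]; exact: le_trans.
Qed.

End Iteration.

(** * Behaviour at infinity *)

Section Asymptotics.
Context {R : realType}.

Lemma bounded_on_Rplus (g : R -> R) :
  {within Rplus R, continuous g} -> g t @[t --> +oo] --> (0 : R) ->
  exists M, forall t, 0 <= t -> g t <= M.
Proof.
move=> gc g0; have [A [_ Ag]] : \forall t \near +oo, g t < 1 by exact: cvgr_lt g0 _ ltr01.
pose r := Num.max 0 A; have r0 : 0 <= r by rewrite le_max lexx.
have gcr : {within `[0, r], continuous g}.
  by apply: continuous_subspaceW gc => t; rewrite RplusE /= in_itv/= => /andP[].
have [c _ gmax] := EVT_max r0 gcr.
exists (Num.max 1 (g c)) => t t0; rewrite le_max; apply/orP.
have [rt|tr] := ltP r t; [left|right].
  by apply: ltW; apply: Ag; apply: le_lt_trans rt; rewrite le_max lexx orbT.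
by apply: gmax; rewrite in_itv/= t0.
Qed.

(** [m t <= t * m t] from 1 on, and [m] is bounded on [0, 1]. *)
Lemma Iplus_lty_of_moment (m : R -> R) (M : R) :
  measurable_fun (Rplus R) m -> (forall t, 0 <= t -> 0 <= m t) -> 0 <= M ->
  (forall t, 0 <= t -> m t <= M) -> (Iplus (fun t => t * m t)%R < +oo)%E ->
  (Iplus m < +oo)%E.
Proof.
move=> mm m0 M0 mM m_mom.
pose c (t : R) := if (0 <= t) && (t <= 1) then M else 0.
have mc : measurable_fun (Rplus R) c by exact: measurable_cst_itv.
have mtm : measurable_fun (Rplus R) (fun t => t * m t) by exact: measurable_funM.
apply: (@le_lt_trans _ _ (Iplus (fun t => c t + t * m t))%R).
  apply: le_Iplus => // [|t t0]; first exact: measurable_funD.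
  rewrite m0//= /c t0 /=; have [t1|/ltW t1] := leP t 1.
    by apply: (le_trans (mM t t0)); rewrite lerDl mulr_ge0 ?m0.
  by rewrite add0r ler_peMl ?m0.
rewrite IplusD//; last by move=> t t0; rewrite mulr_ge0 ?m0.
  rewrite /c Iplus_cst_itv//; apply: lte_add_pinfty => //; exact: ltry.
by move=> t _; rewrite /c; case: ifP.
Qed.

Context (f : R -> R) (gamma B : R).
Context (gamma0 : 0 < gamma) (B0 : 0 <= B).
Context (f_bounds : forall t, 0 <= t -> gamma * t <= f t <= B + gamma * t).

Lemma linear_growth_of_bounds : linear_growth f.
Proof.
exists gamma, (gamma + B); split => //; first exact: ltr_pwDl.
near=> x; have x1 : 1 <= x by near: x; exact: nbhs_pinfty_ge.
have x0 : 0 <= x by exact: le_trans x1.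
have /andP[-> /= fx] := f_bounds x0; apply: (le_trans fx).
by rewrite addrC mulrDl lerD2l ler_peMr.
Unshelve. all: by end_near. Qed.

Lemma slope_of_bounds : f x / x @[x --> +oo] --> gamma.
Proof.
apply/cvgrPdist_le => e e0; near=> x.
have x1 : 1 <= x by near: x; exact: nbhs_pinfty_ge.
have xB : B / e <= x by near: x; apply: nbhs_pinfty_ge; exact: num_real.
have x0 : 0 < x by exact: lt_le_trans x1.
have /andP[gf fB] := f_bounds (ltW x0).
have Bex : B <= e * x by rewrite mulrC -ler_pdivrMr.
have -> : gamma - f x / x = (gamma * x - f x) / x by rewrite mulrBl mulfK// gt_eqF.
by rewrite normrM normfV (gtr0_norm x0) ler_pdivrMr// ler_norml; lra.
Unshelve. all: by end_near. Qed.

End Asymptotics.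

Theorem theorem1 (R : realType) (K : R -> R) (w1 : R -> R -> R)
    (K_pos : forall x : R, 0 < K x)
    (K_even : forall t : R, 0 <= t -> K (- t) = K t)
    (K_derivable : forall x : R, derivable K x 1)
    (K'_continuous : continuous (derive1 K))
    (K_bounded : bounded_fun K)
    (K'_bounded : bounded_fun (derive1 K))
    (K_decreasing : forall s t : R, 0 <= s -> s < t -> K t < K s)
    (K_integral :
      (\int[lebesgue_measure]_(t in Rplus R) (K t)%:E = (2^-1)%:E)%E)
    (K_moment :
      (\int[lebesgue_measure]_(t in Rplus R) (t * K t)%:E < +oo)%E)
    (w1_zero : forall t : R, 0 <= t -> w1 t 0 = 0)
    (w1_continuous :
      {within Rplus R `*` Rplus R, continuous (fun p : R * R => w1 p.1 p.2)})
    (w1_increasing :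
      forall t u v : R, 0 <= t -> 0 <= u -> u < v -> w1 t u < w1 t v)
    (w1_has_sup : forall t : R, 0 <= t -> has_sup [set w1 t u | u in Rplus R])
    (mu1_continuous : {within Rplus R, continuous (sup_on_Rplus w1)})
    (mu1_limit : sup_on_Rplus w1 t @[t --> +oo] --> (0 : R))
    (mu1_moment :
      (\int[lebesgue_measure]_(t in Rplus R) (t * sup_on_Rplus w1 t)%:E
        < +oo)%E) :
  exists f : R -> R -> R, forall gamma : R, 0 < gamma ->
    [/\ is_solution K w1 (f gamma),
        {within Rplus R, continuous (f gamma)},
        linear_growth (f gamma)
      & f gamma x / x @[x --> +oo] --> gamma].
Proof.
pose m := sup_on_Rplus w1.
have K_sym x : K (- x) = K x.
  have [x0|x0] := leP 0 x; first exact: K_even.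
  have Nx0 : 0 <= - x by rewrite oppr_ge0 ltW.
  by rewrite -(K_even _ Nx0) opprK.
have K_cont : continuous K.
  by move=> x; apply: differentiable_continuous; apply/derivable1_diffP.
have K_noninc s t : 0 <= s -> s <= t -> K t <= K s.
  move=> s0; rewrite le_eqVlt => /predU1P[->//|st].
  exact: ltW (K_decreasing _ _ s0 st).
have w_ge0 t u : 0 <= t -> 0 <= u -> 0 <= w1 t u.
  move=> t0; rewrite le_eqVlt => /predU1P[<-|u0]; first by rewrite w1_zero.
  by rewrite -(w1_zero _ t0) ltW// w1_increasing.
have w_mono t u v : 0 <= t -> 0 <= u -> u <= v -> w1 t u <= w1 t v.
  move=> t0 u0; rewrite le_eqVlt => /predU1P[->//|uv].
  exact: ltW (w1_increasing _ _ _ t0 u0 uv).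
have w_le t u : 0 <= t -> 0 <= u -> w1 t u <= m t.
  move=> t0 u0; apply: ub_le_sup; first by have [] := w1_has_sup _ t0.
  by exists u => //; rewrite RplusE.
have m0 t : 0 <= t -> 0 <= m t.
  by move=> t0; rewrite -(w1_zero _ t0) w_le.
have mm : measurable_fun (Rplus R) m by exact: within_continuous_measurable.
have [M mM] := bounded_on_Rplus mu1_continuous mu1_limit.
have M0 : 0 <= M by rewrite (le_trans (m0 0 (lexx 0)))// mM.
have m_int : (Iplus m < +oo)%E.
  exact: Iplus_lty_of_moment mm m0 M0 mM mu1_moment.
suff H (gamma : R) : exists f : R -> R, 0 < gamma ->
    [/\ is_solution K w1 f, {within Rplus R, continuous f},
        linear_growth f & f x / x @[x --> +oo] --> gamma].
  by have [f fP] := choice H; exists f.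
have [g0|_] := boolP (0 < gamma); last by exists id.
have [U [B B0 [mU U_bounds U_super]]] := supersolution_exists K_cont K_pos K_sym K_noninc
  K_integral K_moment mm m0 m_int mu1_moment (ltW g0).
have [f_sol f_cont f_bounds] := iterate_limit_solution K_cont K_pos K_sym K_noninc
  K_integral K_moment w1_continuous w_ge0 w_mono w_le mm mM mU (ltW g0) B0 M0 U_bounds U_super.
exists (iterate_limit K w1 gamma) => _; split => //.
  exact: linear_growth_of_bounds f_bounds.
exact: slope_of_bounds f_bounds.
Qed.
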